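(* Let $\mathbb{F}$ be a division ring, $n$ a positive integer, $\sigma:\mathbb{F}\to\mathbb{F}^{n\times n}$ a ring morphism and $\delta:\mathbb{F}\to\mathbb{F}^n$ a $\sigma$-derivation. Let $\mathbf{a},\mathbf{b}\in\mathbb{F}^n$ be such that $\mathbb{F}$ has finite right dimension over $K_{\mathbf{a}}$. There exists $\beta\in\mathbb{F}^*$ such that $\mathbf{b}=\mathcal{D}_{\mathbf{a}}(\beta)\beta^{-1}$ if, and only if, $F(\mathbf{b})=0$ for all $F\in I(\mathcal{C}(\mathbf{a}))$.
   Context: Rings are associative with identity, not necessarily commutative, and ring morphisms preserve identities. $\mathbb{F}^*=\mathbb{F}\setminus\{0\}$ and $\mathbb{F}^n$ denotes column vectors. A map $\delta:\mathbb{F}\to\mathbb{F}^n$ is a $\sigma$-derivation if $\delta(a+b)=\delta(a)+\delta(b)$ and $\delta(ab)=\sigma(a)\delta(b)+\delta(a)b$ for all $a,b\in\mathbb{F}$. Free skew polynomial ring: let $\mathcal{M}$ be the free monoid on pairwise distinct variables $x_1,\dots,x_n$. $\mathbb{F}[\mathbf{x};\sigma,\delta]$ is the left $\mathbb{F}$-vector space with basis $\mathcal{M}$, with the ring product given by concatenating monomials and $x_i a=\sum_{j=1}^n\sigma_{i,j}(a)x_j+\delta_i(a)$ for $a\in\mathbb{F}$. Skew evaluation: for $\mathbf{a}=(a_1,\dots,a_n)\in\mathbb{F}^n$ and $F\in\mathbb{F}[\mathbf{x};\sigma,\delta]$, $F(\mathbf{a})$ is the unique element of $\mathbb{F}$ such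 that $F-F(\mathbf{a})$ belongs to the left ideal generated by $x_1-a_1,\dots,x_n-a_n$. For $\Omega\subseteq\mathbb{F}^n$, $I(\Omega)=\{F\in\mathbb{F}[\mathbf{x};\sigma,\delta]\mid F(\mathbf{c})=0\ \forall\mathbf{c}\in\Omega\}$. $\mathcal{D}_{\mathbf{a}}(\beta)=\sigma(\beta)\mathbf{a}+\delta(\beta)\in\mathbb{F}^n$ for $\beta\in\mathbb{F}$; $\mathcal{C}(\mathbf{a})=\{\mathcal{D}_{\mathbf{a}}(\beta)\beta^{-1}\mid\beta\in\mathbb{F}^*\}$ is the conjugacy class of $\mathbf{a}$; $K_{\mathbf{a}}=\{\beta\in\mathbb{F}\mid\mathcal{D}_{\mathbf{a}}(\beta)=\mathbf{a}\beta\}$ is the centralizer, a division subring of $\mathbb{F}$. *)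

(* Defs.v *)
From HB Require Import structures.
From mathcomp Require Import all_boot all_order all_algebra.
From mathcomp Require Import finmap boolp classical_sets monalg.

Set Implicit Arguments.
Unset Strict Implicit.
Unset Printing Implicit Defensive.

Import GRing.Theory.
Local Open Scope ring_scope.

(* v *r b is v with every entry multiplied on the right by b; it differs from
   the library's b *: v, as F need not be commutative. *)
Definition rscale (F : nzRingType) (n : nat) (v : 'cV[F]_n) (b : F) : 'cV[F]_n :=
  \col_i (v i 0 * b).

Notation "v *r b" := (rscale v b) (at level 40, left associativity) : ring_scope.

Record skew_derivation (F : nzRingType) (n : nat)
    (sigma : {rmorphism F -> 'M[F]_n}) := SkewDerivation {
  skew_der_fun :> F -> 'cV[F]_n;
  skew_derD : forall a b, skew_der_fun (a + b) = skew_der_fun a + skew_der_fun b;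
  skew_derM : forall a b,
    skew_der_fun (a * b) = sigma a *m skew_der_fun b + skew_der_fun a *r b }.

(* The free monoid on x_1, ..., x_n is the type of words seq 'I_n, with
   concatenation. {malg F[seq 'I_n]} is used for its left module structure only:
   the ring structure of monalg, in which scalars commute with the variables,
   is not inherited by this alias. *)
Definition skew_poly (F : nzRingType) (n : nat)
    (sigma : {rmorphism F -> 'M[F]_n}) (delta : skew_derivation sigma) : Type :=
  {malg F[seq 'I_n]}.

HB.instance Definition _ (F : nzRingType) (n : nat)
    (sigma : {rmorphism F -> 'M[F]_n}) (delta : skew_derivation sigma) :=
  GRing.Lmodule.copy (skew_poly delta) {malg F[seq 'I_n]}.

Section SkewPolyOps.
Context (F : nzRingType) (n : nat) (sigma : {rmorphism F -> 'M[F]_n}).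
Context (delta : skew_derivation sigma).
Implicit Types (P Q : skew_poly delta) (w : seq 'I_n).

Definition skew_coef w P : F := mcoeff w (P : {malg F[seq 'I_n]}).

Definition skew_monom w : skew_poly delta := << 1 *g w >>.

Definition skew_supp P : seq (seq 'I_n) := msupp (P : {malg F[seq 'I_n]}).

(* x_i Q, obtained from x_i (a w) = \sum_j sigma_{i,j}(a) x_j w + delta_i(a) w. *)
Definition skew_mulX (i : 'I_n) Q : skew_poly delta :=
  \sum_(w <- skew_supp Q)
    (\sum_j sigma (skew_coef w Q) i j *: skew_monom (j :: w)
     + delta (skew_coef w Q) i 0 *: skew_monom w).

Definition skew_act (V : lmodType F) (T : 'I_n -> V -> V) P (v : V) : V :=
  \sum_(w <- skew_supp P) skew_coef w P *: foldr T v w.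

Definition skew_mul P Q : skew_poly delta := skew_act skew_mulX P Q.

Lemma skew_polyP P Q : (forall w, skew_coef w P = skew_coef w Q) -> P = Q.
Proof. by move=> h; apply/malgP. Qed.

Lemma skew_coefD w P Q : skew_coef w (P + Q) = skew_coef w P + skew_coef w Q.
Proof. exact: mcoeffD. Qed.

Lemma skew_coefZ w c P : skew_coef w (c *: P) = c * skew_coef w P.
Proof. exact: mcoeffZ. Qed.

Lemma skew_coef_monom w w' : skew_coef w (skew_monom w') = (w' == w)%:R.
Proof. exact: mcoeffU. Qed.

Lemma skew_supp_wide (V : lmodType F) (f : F -> seq 'I_n -> V) P
    (d : {fset (seq 'I_n)}) :
  (forall w, f 0 w = 0) -> (msupp (P : {malg F[seq 'I_n]}) `<=` d)%fset ->
  \sum_(w <- skew_supp P) f (skew_coef w P) w = \sum_(w <- d) f (skew_coef w P) w.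
Proof.
move=> f0 le; rewrite /skew_supp; apply: big_fset_incl => // w _ /mcoeff_outdom h.
by rewrite /skew_coef h f0.
Qed.

Lemma skew_sumD (V : lmodType F) (f : F -> seq 'I_n -> V) P Q :
  (forall w, {morph f^~ w : x y / x + y}) ->
  \sum_(w <- skew_supp (P + Q)) f (skew_coef w (P + Q)) w =
  \sum_(w <- skew_supp P) f (skew_coef w P) w +
  \sum_(w <- skew_supp Q) f (skew_coef w Q) w.
Proof.
move=> fD; have f0 w : f 0 w = 0.
  by apply: (addrI (f 0 w)); rewrite -fD !addr0.
rewrite (@skew_supp_wide _ f (P + Q) _ f0 (msuppD_le _ _)).
rewrite (@skew_supp_wide _ f P _ f0
  (fsubsetUl _ (msupp (Q : {malg F[seq 'I_n]})))).
rewrite (@skew_supp_wide _ f Q _ f0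
  (fsubsetUr (msupp (P : {malg F[seq 'I_n]})) _)).
by rewrite -big_split; apply: eq_bigr => w _; rewrite skew_coefD fD.
Qed.

Lemma skew_sumZX (V : lmodType F) (f : F -> seq 'I_n -> V) c w :
  (forall w, f 0 w = 0) ->
  \sum_(u <- skew_supp (c *: skew_monom w)) f (skew_coef u (c *: skew_monom w)) u
  = f c w.
Proof.
move=> f0; rewrite (@skew_supp_wide _ f _ [fset w]%fset f0).
  by rewrite big_seq_fset1 skew_coefZ skew_coef_monom eqxx mulr1.
exact: fsubset_trans (msuppZ_le _ _) msuppU_le.
Qed.

Lemma skew_polyE P : P = \sum_(w <- skew_supp P) skew_coef w P *: skew_monom w.
Proof.
rewrite {1}[P]monalgE; apply: eq_bigr => w _; apply/skew_polyP => u.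
by rewrite skew_coefZ skew_coef_monom /skew_coef mcoeffU mulr_natr.
Qed.

Lemma skew_poly_ind (K : skew_poly delta -> Prop) :
  K 0 -> (forall P Q, K P -> K Q -> K (P + Q)) ->
  (forall c w, K (c *: skew_monom w)) -> forall P, K P.
Proof. by move=> K0 KD KX P; rewrite [P]skew_polyE; elim/big_ind: _. Qed.

Lemma skew_sigmaDij i j : {morph (fun c => sigma c i j) : x y / x + y}.
Proof. by move=> x y; rewrite rmorphD mxE. Qed.

Lemma skew_derDi i : {morph (fun c => delta c i 0) : x y / x + y}.
Proof. by move=> x y; rewrite skew_derD mxE. Qed.

Lemma skew_der0 : delta 0 = 0.
Proof. by apply: (addrI (delta 0)); rewrite -skew_derD !addr0. Qed.

Lemma skew_der1 : delta 1 = 0.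
Proof.
have := skew_derM delta 1 1; rewrite mulr1 rmorph1 mul1mx => h.
apply/matrixP => i j; rewrite ord1; have /matrixP/(_ i 0) := h.
by rewrite !mxE mulr1 -[LHS]addr0 => /addrI <-.
Qed.

Lemma skew_derMi a b i : delta (a * b) i 0 =
  \sum_j sigma a i j * delta b j 0 + delta a i 0 * b.
Proof. by rewrite skew_derM !mxE. Qed.

Let mulXf (V : lmodType F) (g : seq 'I_n -> V) (i : 'I_n) (c : F) w : V :=
  \sum_j sigma c i j *: g (j :: w) + delta c i 0 *: g w.

Let mulXfD V g i w : {morph (@mulXf V g i)^~ w : x y / x + y}.
Proof.
move=> x y /=; rewrite /mulXf addrACA -big_split /=; congr (_ + _).
  by apply: eq_bigr => j _; rewrite skew_sigmaDij scalerDl.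
by rewrite skew_derDi scalerDl.
Qed.

Lemma skew_mulXD i : {morph skew_mulX i : P Q / P + Q}.
Proof. by move=> P Q; apply: (skew_sumD _ _ (@mulXfD _ skew_monom i)). Qed.

Lemma skew_mulX0 i : skew_mulX i 0 = 0.
Proof. by apply: (addrI (skew_mulX i 0)); rewrite -skew_mulXD !addr0. Qed.

Lemma skew_mulXZX i c w : skew_mulX i (c *: skew_monom w) =
  \sum_j sigma c i j *: skew_monom (j :: w) + delta c i 0 *: skew_monom w.
Proof.
apply: (@skew_sumZX _ (mulXf skew_monom i)) => u.
by rewrite /mulXf skew_der0 rmorph0 mxE scale0r addr0 big1 // => j _; rewrite mxE scale0r.
Qed.

Lemma skew_mulXX i w : skew_mulX i (skew_monom w) = skew_monom (i :: w).
Proof.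
rewrite -[skew_monom w]scale1r skew_mulXZX skew_der1 mxE scale0r addr0 rmorph1.
rewrite (bigD1 i) //= big1 ?addr0; first by rewrite mxE eqxx scale1r.
by move=> j ji; rewrite mxE eq_sym (negPf ji) scale0r.
Qed.

(* T satisfies the commutation rule of the variables with scalars. *)
Definition skew_linear (V : lmodType F) (T : 'I_n -> V -> V) :=
  (forall i, {morph T i : u v / u + v}) /\
  (forall i c v, T i (c *: v) = \sum_j sigma c i j *: T j v + delta c i 0 *: v).

Lemma skew_mulX_linear : skew_linear skew_mulX.
Proof.
split=> [i|i c P]; first exact: skew_mulXD.
elim/skew_poly_ind: P => [|P Q hP hQ|b w].
- rewrite !scaler0 skew_mulX0 addr0 big1 // => j _.
  by rewrite skew_mulX0 scaler0.
- rewrite (scalerDr c) skew_mulXD hP hQ addrACA -(scalerDr (delta c i 0)).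
  congr (_ + _); rewrite -big_split; apply: eq_bigr => j _.
  by rewrite skew_mulXD scalerDr.
rewrite scalerA skew_mulXZX skew_derMi scalerDl addrA scalerA; congr (_ + _).
under [RHS]eq_bigr => j _ do rewrite skew_mulXZX scalerDr scaler_sumr scalerA.
rewrite big_split /= -scaler_suml; congr (_ + _).
rewrite exchange_big /=; apply: eq_bigr => j _.
rewrite rmorphM mxE scaler_suml; apply: eq_bigr => k _.
by rewrite scalerA.
Qed.

Section Act.
Context (V : lmodType F) (T : 'I_n -> V -> V) (hT : skew_linear T).

Lemma skew_actDl P Q v : skew_act T (P + Q) v = skew_act T P v + skew_act T Q v.
Proof.
by apply: (skew_sumD (f := fun c w => c *: foldr T v w)) => w x y; rewrite scalerDl.
Qed.

Lemma skew_act0l v : skew_act T 0 v = 0.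
Proof. by apply: (addrI (skew_act T 0 v)); rewrite -skew_actDl !addr0. Qed.

Lemma skew_actZX c w v : skew_act T (c *: skew_monom w) v = c *: foldr T v w.
Proof.
by apply: (@skew_sumZX _ (fun c w => c *: foldr T v w)) => u; rewrite scale0r.
Qed.

Lemma skew_actX w v : skew_act T (skew_monom w) v = foldr T v w.
Proof. by rewrite -[skew_monom w]scale1r skew_actZX scale1r. Qed.

Lemma skew_actZl c P v : skew_act T (c *: P) v = c *: skew_act T P v.
Proof.
elim/skew_poly_ind: P => [|P Q hP hQ|b w]; first by rewrite scaler0 skew_act0l scaler0.
  by rewrite scalerDr !skew_actDl hP hQ scalerDr.
by rewrite scalerA !skew_actZX scalerA.
Qed.

Lemma foldr_skewD w : {morph (fun v => foldr T v w) : u v / u + v}.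
Proof. by move=> u v; elim: w => //= i w ->; case: hT => ->. Qed.

Lemma skew_actDr P u v : skew_act T P (u + v) = skew_act T P u + skew_act T P v.
Proof.
rewrite /skew_act -big_split; apply: eq_bigr => w _.
by rewrite foldr_skewD scalerDr.
Qed.

Lemma skew_act_mulX i P v : skew_act T (skew_mulX i P) v = T i (skew_act T P v).
Proof.
have [TD TZ] := hT.
have T0 : T i 0 = 0 by apply: (addrI (T i 0)); rewrite -TD !addr0.
elim/skew_poly_ind: P => [|P Q hP hQ|c w].
- by rewrite skew_mulX0 !skew_act0l T0.
- by rewrite skew_mulXD !skew_actDl hP hQ TD.
rewrite skew_mulXZX skew_actDl !skew_actZX TZ; congr (_ + _).
rewrite (big_morph (skew_act T ^~ v) (fun P Q => skew_actDl P Q v) (skew_act0l v)).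
by apply: eq_bigr => j _; rewrite skew_actZX.
Qed.

Lemma skew_act_mul P Q v : skew_act T (skew_mul P Q) v = skew_act T P (skew_act T Q v).
Proof.
rewrite /skew_mul [skew_act skew_mulX _ _]/skew_act.
rewrite (big_morph (skew_act T ^~ v) (fun P Q => skew_actDl P Q v) (skew_act0l v)).
apply: eq_bigr => w _; rewrite skew_actZl; congr (_ *: _).
by elim: w => //= i w IH; rewrite skew_act_mulX IH.
Qed.

End Act.

Lemma skew_mulA : associative skew_mul.
Proof. by move=> P Q R; rewrite [RHS](skew_act_mul skew_mulX_linear). Qed.

Lemma skew_mul1l : left_id (skew_monom [::]) skew_mul.
Proof. by move=> P; rewrite /skew_mul skew_actX. Qed.

Lemma foldr_mulX w u : foldr skew_mulX (skew_monom u) w = skew_monom (w ++ u).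
Proof. by elim: w => //= i w ->; rewrite skew_mulXX. Qed.

Lemma skew_mul1r : right_id (skew_monom [::]) skew_mul.
Proof.
move=> P; rewrite [RHS]skew_polyE; apply: eq_bigr => w _.
by rewrite foldr_mulX cats0.
Qed.

Lemma skew_mulDl : left_distributive skew_mul +%R.
Proof. by move=> P Q R; apply: skew_actDl. Qed.

Lemma skew_mulDr : right_distributive skew_mul +%R.
Proof. by move=> P Q R; apply: (skew_actDr skew_mulX_linear). Qed.

Lemma skew_1neq0 : skew_monom [::] != 0.
Proof.
apply/eqP => /(congr1 (skew_coef [::])); rewrite skew_coef_monom eqxx => /eqP.
by rewrite [skew_coef _ 0]mcoeff0 oner_eq0.
Qed.

HB.instance Definition _ := GRing.Zmodule_isNzRing.Build (skew_poly delta)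
  skew_mulA skew_mul1l skew_mul1r skew_mulDl skew_mulDr skew_1neq0.

Lemma skew_scalerAl c P Q : c *: (P * Q) = (c *: P) * Q.
Proof. by rewrite /GRing.mul /= /skew_mul skew_actZl. Qed.

HB.instance Definition _ :=
  GRing.Lmodule_isLalgebra.Build F (skew_poly delta) skew_scalerAl.

Definition skewC (c : F) : skew_poly delta := c%:A.

Definition skewX (i : 'I_n) : skew_poly delta := skew_monom [:: i].

Lemma skew_monomM w u : skew_monom w * skew_monom u = skew_monom (w ++ u).
Proof. by rewrite /GRing.mul /= /skew_mul skew_actX foldr_mulX. Qed.

Lemma skewX_mulC i (c : F) :
  skewX i * skewC c = \sum_j sigma c i j *: skewX j + skewC (delta c i 0).
Proof. by rewrite /GRing.mul /= /skew_mul skew_actX /= skew_mulXZX. Qed.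

End SkewPolyOps.

Section SkewEvaluation.
Context (F : nzRingType) (n : nat) (sigma : {rmorphism F -> 'M[F]_n}).
Context (delta : skew_derivation sigma).
Implicit Types (P Q : skew_poly delta) (a c : 'cV[F]_n) (beta : F).

Local Open Scope classical_set_scope.

(* The left ideal generated by x_1 - a_1, ..., x_n - a_n. *)
Definition point_ideal a : set (skew_poly delta) :=
  [set P | exists G : 'I_n -> skew_poly delta,
             P = \sum_i G i * (skewX delta i - skewC delta (a i 0))].

(* The element v with P - v in point_ideal a; it exists and is unique by
   skew_eval_exists_unique, so the default value 0 is never used. *)
Definition skew_eval P a : F := xget 0 [set v | point_ideal a (P - skewC delta v)].

Definition vanishing_ideal (Omega : set 'cV[F]_n) : set (skew_poly delta) :=
  [set P | forall c, Omega c -> skew_eval P c = 0].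

Definition skew_D a beta : 'cV[F]_n := sigma beta *m a + delta beta.

Lemma skew_D_linear a : skew_linear delta (V := F^o) (fun i beta => skew_D a beta i 0).
Proof.
split=> [i u v|i c v]; first by rewrite /skew_D rmorphD skew_derD mulmxDl addrACA mxE.
rewrite /skew_D rmorphM skew_derM addrA -mulmxA -mulmxDr mxE [X in X + _]mxE.
by congr (_ + _); rewrite mxE.
Qed.

Let T a : 'I_n -> F^o -> F^o := fun i beta => skew_D a beta i 0.

Let E a P : F^o := skew_act (T a) P 1.

Let ED a P Q : E a (P + Q) = E a P + E a Q.
Proof. exact: (@skew_actDl F n sigma delta F^o (T a) P Q 1). Qed.

Let E0 a : E a 0 = 0.
Proof. exact: (@skew_act0l F n sigma delta F^o (T a) 1). Qed.

Let EZ a v P : E a (v *: P) = v * E a P.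
Proof. exact: (@skew_actZl F n sigma delta F^o (T a) v P 1). Qed.

Let EX a w : E a (skew_monom delta w) = foldr (T a) 1 w.
Proof. exact: (@skew_actX F n sigma delta F^o (T a) w 1). Qed.

Let EC a v : E a (skewC delta v) = v.
Proof. by rewrite EZ EX mulr1. Qed.

Let EB a P v : E a (P - skewC delta v) = E a P - v.
Proof. by rewrite ED -scaleN1r EZ EC mulN1r. Qed.

Let E_ideal a P : point_ideal a P -> E a P = 0.
Proof.
case=> G ->; elim/big_rec: _ => [|i Q _ hQ]; first exact: E0.
rewrite ED hQ addr0.
have -> R : E a (G i * R) = skew_act (T a) (G i) (E a R).
  exact: (skew_act_mul (skew_D_linear a)).
rewrite EB EX /= /T /skew_D rmorph1 mul1mx skew_der1 addr0 subrr.
rewrite /skew_act big1 // => w _.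
suff -> : foldr (T a) 0 w = 0 by rewrite scaler0.
by elim: w => //= j w ->; rewrite /T /skew_D rmorph0 mul0mx skew_der0 addr0 mxE.
Qed.

Let idealD a P Q : point_ideal a P -> point_ideal a Q -> point_ideal a (P + Q).
Proof.
move=> [G ->] [H ->]; exists (fun i => G i + H i).
by rewrite -big_split; apply: eq_bigr => i _; rewrite mulrDl.
Qed.

Let idealM a R P : point_ideal a P -> point_ideal a (R * P).
Proof.
move=> [G ->]; exists (fun i => R * G i).
by rewrite mulr_sumr; apply: eq_bigr => i _; rewrite mulrA.
Qed.

Let skewCM v P : skewC delta v * P = v *: P.
Proof. by rewrite /skewC -skew_scalerAl mul1r. Qed.

Let skewCD u v : skewC delta (u + v) = skewC delta u + skewC delta v.
Proof. exact: scalerDl. Qed.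

Let skewCsum (I : finType) (f : I -> F) :
  skewC delta (\sum_i f i) = \sum_i skewC delta (f i).
Proof. by rewrite /skewC scaler_suml. Qed.

Let ideal_eval a P : point_ideal a (P - skewC delta (E a P)).
Proof.
elim/skew_poly_ind: P => [|P Q hP hQ|c w].
- exists (fun=> 0); rewrite E0 /skewC scale0r subr0.
  by rewrite big1 // => i _; rewrite mul0r.
- by rewrite ED skewCD opprD addrACA; apply: idealD.
rewrite EZ EX; set t := foldr _ _ _.
have -> : skewC delta (c *: t) = skewC delta c * skewC delta t.
  by rewrite skewCM /skewC scalerA.
rewrite -skewCM -mulrBr; apply: idealM; rewrite {}/t.
elim: w => [|i w IH] /=.
  rewrite /skewC scale1r subrr; exists (fun=> 0).
  by rewrite big1 // => i _; rewrite mul0r.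
set t := foldr _ _ _ in IH *.
have -> : skew_monom delta (i :: w) - skewC delta (skew_D a t i 0) =
  skewX delta i * (skew_monom delta w - skewC delta t) +
  \sum_j skewC delta (sigma t i j) * (skewX delta j - skewC delta (a j 0)).
  have -> : \sum_j skewC delta (sigma t i j) * (skewX delta j - skewC delta (a j 0))
      = \sum_j sigma t i j *: skewX delta j - skewC delta ((sigma t *m a) i 0).
    rewrite mxE skewCsum -sumrB; apply: eq_bigr => j _.
    by rewrite mulrBr !skewCM /skewC scalerA.
  rewrite mulrBr skewX_mulC.
  rewrite skew_monomM /skew_D mxE skewCD -addrA; congr (_ + _).
  by rewrite !opprD addrACA addNr add0r addrC.
apply: idealD; first exact: idealM.
by exists (fun j => skewC delta (sigma t i j)).
Qed.

Lemma skew_eval_exists_unique P a :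
  exists! v, point_ideal a (P - skewC delta v).
Proof.
exists (E a P); split=> [|v /E_ideal]; first exact: ideal_eval.
by rewrite EB => /eqP; rewrite subr_eq0 => /eqP.
Qed.

Lemma skew_evalP P a : point_ideal a (P - skewC delta (skew_eval P a)).
Proof.
have [v [hv _]] := skew_eval_exists_unique P a.
by apply: (@xgetPex _ 0 [set v | point_ideal a (P - skewC delta v)]); exists v.
Qed.

Definition centralizer a : {pred F} := [pred beta | skew_D a beta == a *r beta].

End SkewEvaluation.

Definition conjugacy_class (F : unitRingType) (n : nat)
    (sigma : {rmorphism F -> 'M[F]_n}) (delta : skew_derivation sigma)
    (a : 'cV[F]_n) : set 'cV[F]_n :=
  [set c | exists beta : F, beta != 0 /\ c = skew_D delta a beta *r beta^-1]%classic.

Lemma centralizer_divring_closed (F : unitRingType) (n : nat)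
    (sigma : {rmorphism F -> 'M[F]_n}) (delta : skew_derivation sigma)
    (a : 'cV[F]_n) : GRing.divring_closed (centralizer delta a).
Proof.
have rA (v : 'cV[F]_n) x y : v *r x *r y = v *r (x * y).
  by apply/matrixP => i j; rewrite !mxE mulrA.
have rDl (u v : 'cV[F]_n) x : (u + v) *r x = u *r x + v *r x.
  by apply/matrixP => i j; rewrite !mxE mulrDl.
have rM (M : 'M[F]_n) (v : 'cV[F]_n) x : (M *m v) *r x = M *m (v *r x).
  apply/matrixP => i j; rewrite !mxE mulr_suml.
  by apply: eq_bigr => k _; rewrite !mxE mulrA.
have DM x y : skew_D delta a (x * y) = sigma x *m skew_D delta a y + delta x *r y.
  by rewrite /skew_D rmorphM skew_derM addrA -mulmxA -mulmxDr.
have D1 : skew_D delta a 1 = a by rewrite /skew_D rmorph1 mul1mx skew_der1 addr0.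
have r1 (v : 'cV[F]_n) : v *r 1 = v.
  by apply/matrixP => i j; rewrite !mxE mulr1 ord1.
have DMK x y : skew_D delta a x = a *r x -> skew_D delta a y = a *r y ->
    skew_D delta a (x * y) = a *r (x * y).
  by move=> hx hy; rewrite DM hy -rM -rDl -/(skew_D delta a x) hx rA.
split=> [|x y|x y]; rewrite !inE.
- by rewrite D1 r1.
- move=> /eqP hx /eqP hy; apply/eqP/matrixP => i j.
  have B : skew_D delta a (x - y) + skew_D delta a y = skew_D delta a x.
    by rewrite /skew_D addrACA -mulmxDl -rmorphD -skew_derD subrK.
  have -> : skew_D delta a (x - y) = a *r x - a *r y by rewrite -hx -hy -B addrK.
  by rewrite !mxE mulrBr.
move=> /eqP hx /eqP hy; apply/eqP/DMK => //.
have [yU|/invr_out -> //] := boolP (y \is a GRing.unit).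
have h : sigma y *m skew_D delta a y^-1 = sigma y *m (a *r y^-1).
  apply: (addIr (delta y *r y^-1)).
  by rewrite -DM mulrV // D1 -rM -rDl -/(skew_D delta a y) hy rA mulrV // r1.
have := congr1 (mulmx (sigma y^-1)) h.
rewrite !mulmxA; have -> : sigma y^-1 *m sigma y = 1%:M.
  by rewrite -[_ *m _](rmorphM sigma) mulVr // rmorph1.
by rewrite !mul1mx.
Qed.

Definition right_basis (F : nzRingType) (K : {pred F}) (d : nat) (e : 'I_d -> F) :=
  forall x : F, exists! k : {ffun 'I_d -> F},
    (forall i, k i \in K) /\ x = \sum_i e i * k i.

Definition finite_right_dim (F : nzRingType) (K : {pred F}) : Prop :=
  exists (d : nat) (e : 'I_d -> F), right_basis K e.

(* Main.v *)
Require Import Defs.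
From mathcomp Require Import all_boot all_order all_algebra.
From mathcomp Require Import boolp classical_sets.

Import GRing.Theory.
Local Open Scope ring_scope.

(** The skew polynomial ring acts on F with x_i acting as the i-th entry of D_a,
    and P . beta = P(c) beta whenever D_a(beta) = c beta, so I(C(a)) is the
    annihilator of this module M_a. As the action is right linear over the
    centralizer, I(C(a)) is also the annihilator of a finite right basis
    e_1, ..., e_d of F. If it kills the generator 1 of M_b, take the first k such
    that every P annihilating e_1, ..., e_k kills 1 in M_b, and some P_0
    annihilating e_1, ..., e_{k-1} with P_0(b) = 1. Then beta = P_0 . e_k is
    nonzero, and for Q = x_i P_0 - D_a(beta)_i beta^-1 P_0 one has Q . e_k = 0,
    hence 0 = Q(b) = b_i - D_a(beta)_i beta^-1. *)

Section SkewAction.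
Context {F : nzRingType} {n : nat} {sigma : {rmorphism F -> 'M[F]_n}}.
Context {delta : skew_derivation sigma}.
Implicit Types (P Q : skew_poly delta) (a c : 'cV[F]_n) (x y k beta : F).

Definition D_op a : 'I_n -> F^o -> F^o := fun i beta => skew_D delta a beta i 0.

(** This is the action of P on the module $M_a$; [F^o] supplies the left vector space structure. *)
Definition D_act a P beta : F := skew_act (D_op a) P (beta : F^o).

Lemma D_act_mul a P Q beta : D_act a (P * Q) beta = D_act a P (D_act a Q beta).
Proof. exact: (skew_act_mul (skew_D_linear delta a)). Qed.

Lemma D_actDl a P Q beta : D_act a (P + Q) beta = D_act a P beta + D_act a Q beta.
Proof. exact: (@skew_actDl F n sigma delta F^o). Qed.

Lemma D_actZl a x P beta : D_act a (x *: P) beta = x * D_act a P beta.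
Proof. exact: (@skew_actZl F n sigma delta F^o). Qed.

Lemma D_actBl a P Q beta : D_act a (P - Q) beta = D_act a P beta - D_act a Q beta.
Proof. by rewrite D_actDl -scaleN1r D_actZl mulN1r. Qed.

Lemma D_act0l a beta : D_act a 0 beta = 0.
Proof. exact: (@skew_act0l F n sigma delta F^o). Qed.

Lemma D_actDr a P x y : D_act a P (x + y) = D_act a P x + D_act a P y.
Proof. exact: (skew_actDr (skew_D_linear delta a)). Qed.

Lemma D_act0r a P : D_act a P 0 = 0.
Proof. by apply: (addrI (D_act a P 0)); rewrite -D_actDr !addr0. Qed.

Lemma D_act1 a beta : D_act a 1 beta = beta.
Proof. exact: (@skew_actX F n sigma delta F^o (D_op a) [::]). Qed.

Lemma D_actX a i beta : D_act a (skewX delta i) beta = skew_D delta a beta i 0.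
Proof. exact: (@skew_actX F n sigma delta F^o (D_op a) [:: i]). Qed.

(** P - P(c) lies in the left ideal generated by the $x_i - c_i$, and each of these kills [beta] in
    $M_a$. *)
Lemma D_act_eval a c P beta :
  skew_D delta a beta = c *r beta -> D_act a P beta = skew_eval P c * beta.
Proof.
move=> hc; have [G hG] := skew_evalP P c.
apply/eqP; rewrite -subr_eq0 -[X in _ - _ * X](D_act1 a) -D_actZl -D_actBl.
rewrite -/(skewC delta _) hG; apply/eqP.
elim/big_rec: _ => [|i Q _ hQ]; first exact: D_act0l.
rewrite D_actDl hQ addr0 D_act_mul D_actBl D_actX D_actZl D_act1 hc mxE subrr.
exact: D_act0r.
Qed.

(** The form [a *r 1] fits the hypothesis of [D_act_eval], so evaluation at [a] is the action on the
    generator 1. *)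
Lemma skew_D1 a : skew_D delta a 1 = a *r 1.
Proof.
by apply/matrixP => i j; rewrite /skew_D rmorph1 mul1mx skew_der1 addr0 mxE mulr1 ord1.
Qed.

Lemma skew_eval_act P a : skew_eval P a = D_act a P 1.
Proof. by rewrite (D_act_eval _ _ _ _ (skew_D1 a)) mulr1. Qed.

(** The product rule gives $\sigma(x) D_a(k) + \delta(x) k$, where $D_a(k) = a k$. *)
Lemma skew_DMr a x k : k \in centralizer delta a ->
  skew_D delta a (x * k) = skew_D delta a x *r k.
Proof.
rewrite inE => /eqP hk.
rewrite {1}/skew_D rmorphM skew_derM addrA -mulmxA -mulmxDr -/(skew_D delta a k) hk.
apply/matrixP => i j; rewrite !mxE mulrDl mulr_suml ord1; congr (_ + _).
by apply: eq_bigr => l _; rewrite mxE mulrA.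
Qed.

Lemma D_actMr a P x k : k \in centralizer delta a ->
  D_act a P (x * k) = D_act a P x * k.
Proof.
move=> hk; rewrite /D_act /skew_act mulr_suml; apply: eq_bigr => w _.
change (skew_coef w P * foldr (D_op a) (x * k) w =
        skew_coef w P * foldr (D_op a) x w * k).
rewrite -mulrA; congr (_ * _).
by elim: w => //= i w ->; rewrite {1}/D_op skew_DMr // mxE.
Qed.

Lemma D_act_basis a P d (e : 'I_d -> F) :
  right_basis (centralizer delta a) e ->
  (forall i, D_act a P (e i) = 0) -> forall x, D_act a P x = 0.
Proof.
move=> he h0 x; have [k [[hk ->] _]] := he x.
rewrite (big_morph (D_act a P) (D_actDr a P) (D_act0r a P)) big1 // => i _.
by rewrite D_actMr // h0 mul0r.
Qed.

End SkewAction.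

Section DivisionRing.
Context {F : unitRingType} (divF : forall x : F, x != 0 -> x \is a GRing.unit).
Context {n : nat} {sigma : {rmorphism F -> 'M[F]_n}} {delta : skew_derivation sigma}.
Implicit Types (P Q : skew_poly delta) (a b : 'cV[F]_n) (beta : F).

Lemma skew_D_conjugate a b beta : beta != 0 ->
  (b = skew_D delta a beta *r beta^-1) <-> (skew_D delta a beta = b *r beta).
Proof.
move=> /divF uB; split=> ->; apply/matrixP => i j; rewrite !mxE ord1.
  by rewrite mulrVK.
by rewrite mulrK.
Qed.

(** Induction on [s] plays the role of the least k: either the tail already satisfies the
    hypothesis, or some P kills the tail but not 1 in $M_b$. *)
Lemma conjugate_of_annihilator a b (s : seq F) :
  (forall P, (forall x, x \in s -> D_act a P x = 0) -> D_act b P 1 = 0) ->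
  exists beta, beta != 0 /\ skew_D delta a beta = b *r beta.
Proof.
elim: s => [|e s IH] hs.
  (* With no element to annihilate, P = 1 qualifies and would give 1 = 0. *)
  have /eqP : D_act b (1 : skew_poly delta) 1 = 0 by exact: hs.
  by rewrite D_act1 oner_eq0.
have [//|/existsNP[P /not_implyP[Ps /eqP Pb]]] :=
  pselect (forall P, (forall x, x \in s -> D_act a P x = 0) -> D_act b P 1 = 0).
pose P0 : skew_poly delta := (D_act b P 1)^-1 *: P.
have P0s x : x \in s -> D_act a P0 x = 0 by move=> /Ps h; rewrite D_actZl h mulr0.
have P0b : D_act b P0 1 = 1 by rewrite D_actZl mulVr // divF.
clearbody P0.
have kill Q : (forall x, x \in s -> D_act a Q x = 0) -> D_act a Q e = 0 ->
    D_act b Q 1 = 0.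
  by move=> Qs Qe; apply: hs => x; rewrite inE => /predU1P[->|/Qs].
have beta0 : D_act a P0 e != 0.
  by apply/eqP => /(kill P0 P0s)/eqP; rewrite P0b oner_eq0.
exists (D_act a P0 e); split=> //; set beta := D_act a P0 e in beta0 *.
apply/matrixP => i j; rewrite ord1 [RHS]mxE.
(* At [e] both terms take the value $D_a(\beta)_i$; on [s] both vanish with [P0]. *)
have := kill (skewX delta i * P0 - (skew_D delta a beta i 0 / beta) *: P0).
rewrite !D_actBl !D_act_mul !D_actX !D_actZl P0b skew_D1 -/beta.
rewrite mulrVK ?divF // subrr [(b *r 1) i 0]mxE !mulr1 => h.
have /eqP : b i 0 - skew_D delta a beta i 0 / beta = 0.
  apply: h => // x hx.
  by rewrite D_actBl D_act_mul D_actZl P0s // D_act0r mulr0 subr0.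
by rewrite subr_eq0 => /eqP ->; rewrite mulrVK ?divF.
Qed.

End DivisionRing.

Theorem theorem13 (F : unitRingType)
    (divF : forall x : F, x != 0 -> x \is a GRing.unit)
    (n : nat) (n_gt0 : (0 < n)%N)
    (sigma : {rmorphism F -> 'M[F]_n}) (delta : skew_derivation sigma)
    (a b : 'cV[F]_n)
    (fdim : finite_right_dim (centralizer delta a)) :
  (exists beta : F, beta != 0 /\ b = skew_D delta a beta *r beta^-1) <->
  (forall P : skew_poly delta,
     vanishing_ideal (conjugacy_class delta a) P -> skew_eval P b = 0).
Proof.
(* Here [hb] says that [b] itself lies in the conjugacy class. *)
split=> [hb P|hI]; first exact.
have [d [e he]] := fdim.
have [|beta [beta0 hbeta]] :=
    @conjugate_of_annihilator _ divF _ _ delta a b [seq e i | i : 'I_d].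
  move=> P hP; rewrite -skew_eval_act; apply: hI => c [beta [beta0]].
  move=> /(skew_D_conjugate divF _ _ _ beta0) hc.
  (* P(c) = 0 follows from $P(c)\beta = P \cdot \beta = 0$ by cancelling [beta]. *)
  apply: (mulIr (divF _ beta0)); rewrite -(D_act_eval _ _ _ _ hc) mul0r.
  apply: (D_act_basis _ _ _ _ he) => i.
  by apply: hP; apply: map_f; rewrite mem_enum.
by exists beta; split=> //; apply/(skew_D_conjugate divF).
Qed.
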